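(* For any real $x \ge 0$ and $\alpha \in [0,1]$, we have $$\frac{\widehat{\Pi}(x,\alpha)}{\Pi(x+\alpha)} = \exp\left(\int_1^{\infty} \frac{\phi_\alpha(t)}{x+t}\,dt\right),$$ or, restating the identity in terms of the gamma function, $$\frac{\Gamma(y+1)}{\Gamma(y+s)} = y^{1-s}\exp\left(\int_0^{\infty} \frac{\phi_s(t)}{y+t}\,dt\right)$$ for any real $y \ge 1$ and $s \in [0,1]$.
   Context: $\Gamma$ is Euler's gamma function and $\Pi(x) := \Gamma(x+1)=\int_0^\infty t^x e^{-t}\,dt$ for real $x \ge 0$. For $x \ge 0$ and $\alpha\in[0,1]$, $\widehat{\Pi}(x,\alpha) := \Pi(x)^{1-\alpha}\,\Pi(x+1)^{\alpha} = \Pi(x)(x+1)^\alpha$. For $t\in\mathbb{R}$, $\{t\} := t-\lfloor t\rfloor \in [0,1)$ is the fractional part. For $\alpha\in[0,1]$, the function $\phi_\alpha:\mathbb{R}\to\mathbb{R}$ is defined by $\phi_\alpha(t) = 1-\alpha$ if $\{t\}\le\alpha$ and $\phi_\alpha(t) = -\alpha$ if $\{t\}>\alpha$. The integrals over unbounded intervals are improper integrals, i.e. $\int_a^\infty f(t)\,dt = \lim_{T\to\infty}\int_a^T f(t)\,dt$ (existence of the limit being part of the assertion). *)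

(* Defs.v *)
From Stdlib Require Import Reals R_Ifp.
From Coquelicot Require Import Coquelicot.
Open Scope R_scope.

(* The lower limit is taken along [at_right 0] because the integrand is singular
   at 0 when [x < 1]; the integral converges exactly when [0 < x], and for other
   [x] the value of [Gamma x] is unspecified. *)
Definition Gamma (x : R) : R :=
  RInt_gen (fun t => Rpower t (x - 1) * exp (- t))
    (at_right 0) (Rbar_locally p_infty).

Definition Pi (x : R) : R := Gamma (x + 1).

Definition Pi_hat (x alpha : R) : R :=
  Rpower (Pi x) (1 - alpha) * Rpower (Pi (x + 1)) alpha.

(* [frac_part t] is [t - IZR (Int_part t)] with [Int_part] the floor, so it lies
   in [0, 1) for negative [t] too. *)
Definition phi (alpha t : R) : R :=
  if Rle_dec (frac_part t) alpha then 1 - alpha else - alpha.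

(* Improper integrals as limits of Riemann integrals: [is_RInt_gen] with
   [at_point a] and [Rbar_locally p_infty] says that [f] is Riemann integrable on
   [a, T] for all large [T] and that these integrals tend to the given limit. *)
Definition ex_RInt_infty (f : R -> R) (a : R) : Prop :=
  ex_RInt_gen f (at_point a) (Rbar_locally p_infty).

Definition RInt_infty (f : R -> R) (a : R) : R :=
  RInt_gen f (at_point a) (Rbar_locally p_infty).

(* Main.v *)
Require Import Defs.
From Stdlib Require Import Reals.
From Coquelicot Require Import Coquelicot.
From Stdlib Require Import ZArith Lra Lia.
Open Scope R_scope.

(** Put u = c + k, where c is the shift in the integrand phi a t / (c + t) and
    k is the integer at which the integral starts. On a period [k, k + 1] the
    function phi a is a two-valued step with mean zero, so the integral there is

      ln (u + a) - (1 - a) ln u - a ln (u + 1).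

    By Gamma (v + 1) = v Gamma v this is q(u) - q(u + 1) for

      q(u) = ln (Gamma u * u^a / Gamma (u + a)),

    so the integral over n periods telescopes to q(u) - q(u + n)
    ([is_RInt_phi_periods]). Both halves of the theorem assert that the whole
    improper integral is q(u): the first with c = x, k = 1, the second with
    c = y, k = 0.

    It remains to see that q tends to 0 at infinity. This is Wendel's inequality
    Gamma (x + a) <= x^a Gamma x ([Gamma_add_le]), a case of the log-convexity of
    Gamma: it comes from integrating the tangent-line bound
    (t / x)^a <= 1 - a + a t / x against t^(x-1) e^(-t). Used at u with exponent
    a it gives q(u) >= 0; used at u + a with exponent 1 - a it gives
    q(u) <= (1 - a) (ln (u + a) - ln u) <= 1 / u ([log_gamma_quotient_bounds]).

    In every use the argument of Gamma is at least 1. There the integrand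
    t^(x-1) e^(-t) is at most a multiple of e^(-t/2), which gives convergence of
    Euler's integral at both ends of the half-line at once. *)

(** * Improper integrals over the positive half-line *)

(** Reduces an eventual property of the two endpoints to all proper subintervals
    of the positive half-line, which is how the integrands below are controlled. *)
Lemma filter_prod_pos (P : R * R -> Prop) :
  (forall a b, 0 < a -> a <= b -> P (a, b)) ->
  filter_prod (at_right 0) (Rbar_locally p_infty) P.
Proof.
  intros HP.
  apply (Filter_prod _ _ _ (fun a => 0 < a < 1) (fun b => 1 < b)).
  - exists (mkposreal 1 Rlt_0_1); intros a Ha H0.
    apply Rabs_lt_between' in Ha; simpl in Ha; lra.
  - exists 1; auto.
  - intros a b Ha Hb; apply HP; lra.
Qed.

(** Monotone convergence in both endpoints at once: integrals of a nonnegative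
    function grow with the interval, so they converge to their supremum. The
    supremum is returned as an upper bound because positivity of the improper
    integral is read off from a single compact subinterval. *)
Lemma is_RInt_gen_bounded (f : R -> R) (M : R) :
  (forall t, 0 < t -> continuous f t) ->
  (forall t, 0 < t -> 0 <= f t) ->
  (forall a b, 0 < a -> a <= b -> RInt f a b <= M) ->
  exists l, is_RInt_gen f (at_right 0) (Rbar_locally p_infty) l /\
    forall a b, 0 < a -> a <= b -> RInt f a b <= l.
Proof.
  intros Hc Hpos HM.
  assert (Hex : forall a b, 0 < a -> a <= b -> ex_RInt f a b).
  { intros a b Ha Hab; apply (ex_RInt_continuous (V := R_CompleteNormedModule)).
    intros z Hz; rewrite Rmin_left in Hz by lra; apply Hc; lra. }
  destruct (completeness (fun v => exists a b, 0 < a /\ a <= b /\ v = RInt f a b))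
    as [l [Hub Hlub]].
  { exists M; intros v (a & b & Ha & Hab & ->); auto. }
  { exists (RInt f 1 1), 1, 1; repeat split; lra. }
  assert (Hle : forall a b, 0 < a -> a <= b -> RInt f a b <= l).
  { intros a b Ha Hab; apply Hub; exists a, b; auto. }
  exists l; split; [|exact Hle].
  apply filterlimi_locally; intros eps.
  assert (Hnear : exists a b, 0 < a /\ a <= b /\ l - eps < RInt f a b).
  { destruct (Classical_Prop.classic
      (exists a b, 0 < a /\ a <= b /\ l - eps < RInt f a b)) as [H|H]; auto.
    exfalso; assert (l <= l - eps); [|destruct eps; simpl in *; lra].
    apply Hlub; intros v (a & b & Ha & Hab & ->).
    apply Rnot_lt_le; intros Hlt; apply H; exists a, b; auto. }
  destruct Hnear as (a0 & b0 & Ha0 & Hab0 & Hl).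
  apply (Filter_prod _ _ _ (fun a => 0 < a < a0) (fun b => b0 < b)).
  - exists (mkposreal a0 Ha0); intros a Ha H0.
    apply Rabs_lt_between' in Ha; simpl in Ha; lra.
  - exists b0; auto.
  - intros a b Ha Hb; exists (RInt f a b); simpl.
    split; [apply (RInt_correct (V := R_CompleteNormedModule)), Hex; lra|].
    assert (RInt f a b <= l) by (apply Hle; lra).
    assert (RInt f a b = RInt f a a0 + (RInt f a0 b0 + RInt f b0 b)) as Hsplit.
    { change (RInt f a b = plus (RInt f a a0) (plus (RInt f a0 b0) (RInt f b0 b))).
      rewrite !RInt_Chasles; auto; apply Hex; lra. }
    assert (0 <= RInt f a a0).
    { apply RInt_ge_0; [lra|apply Hex; lra|intros; apply Hpos; lra]. }
    assert (0 <= RInt f b0 b).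
    { apply RInt_ge_0; [lra|apply Hex; lra|intros; apply Hpos; lra]. }
    apply Rabs_lt_between'; lra.
Qed.

(** * Euler's integral *)

Definition gamma_integrand (x t : R) : R := Rpower t (x - 1) * exp (- t).

Lemma gamma_integrand_pos x t : 0 < gamma_integrand x t.
Proof. apply Rmult_lt_0_compat; apply exp_pos. Qed.

Lemma gamma_integrand_add (x a t : R) :
  gamma_integrand (x + a) t = Rpower t a * gamma_integrand x t.
Proof.
  unfold gamma_integrand; replace (x + a - 1) with (a + (x - 1)) by ring.
  rewrite Rpower_plus; ring.
Qed.

(** Integration by parts in differential form. *)
Lemma is_derive_gamma_integrand (x t : R) : 0 < t ->
  is_derive (gamma_integrand (x + 1)) t
    (x * gamma_integrand x t - gamma_integrand (x + 1) t).
Proof.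
  intros Ht; unfold gamma_integrand.
  replace (x + 1 - 1) with x by ring.
  evar_last.
  - apply (is_derive_mult (fun u => Rpower u x) (fun u => exp (- u)) t
      (x * Rpower t (x - 1)) (- exp (- t))).
    + apply is_derive_Reals, derivable_pt_lim_power, Ht.
    + auto_derive; auto; ring.
    + intros; apply Rmult_comm.
  - unfold plus, mult; simpl; ring.
Qed.

Lemma continuous_gamma_integrand (x t : R) : 0 < t ->
  continuous (gamma_integrand x) t.
Proof.
  intros Ht; apply (ex_derive_continuous (gamma_integrand x)).
  replace x with (x - 1 + 1) by ring.
  eexists; apply is_derive_gamma_integrand, Ht.
Qed.

(** The power is absorbed by half of the exponential: by concavity of ln,
    (x - 1) ln t grows at most like t / 2 plus a constant. *)
Lemma gamma_integrand_decay (x : R) : 1 <= x ->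
  exists C, 0 < C /\ forall t, 0 < t -> gamma_integrand x t <= C * exp (- t / 2).
Proof.
  (* The tangent to ln at c has slope 1 / c, and p / c <= 1 / 2; the summand 1
     keeps c positive when p = 0. *)
  intros Hx; set (p := x - 1); set (c := 2 * p + 1).
  assert (Hp : 0 <= p) by (unfold p; lra).
  assert (Hc : 0 < c) by (unfold c; lra).
  exists (exp (p * ln c)); split; [apply exp_pos|]; intros t Ht.
  unfold gamma_integrand, Rpower; fold p; rewrite <- !exp_plus.
  assert (Hln : ln t <= t / c - 1 + ln c).
  { replace (ln t) with (ln (t / c) + ln c).
    2:{ rewrite ln_div by lra; ring. }
    assert (H := exp_ineq1_le (ln (t / c))).
    rewrite exp_ln in H by (apply Rdiv_lt_0_compat; lra); lra. }
  assert (Hpc : p * (t / c) <= t / 2).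
  { apply (Rmult_le_reg_r c); [lra|]; field_simplify; [|lra].
    unfold c; nra. }
  assert (p * ln t <= p * (t / c - 1 + ln c)) by (apply Rmult_le_compat_l; lra).
  destruct (Rle_lt_or_eq_dec (p * ln t + - t) (p * ln c + - t / 2)) as [H0|H0].
  - nra.
  - left; apply exp_increasing, H0.
  - rewrite H0; lra.
Qed.

Lemma gamma_integral_exists (x : R) : 1 <= x ->
  exists l, is_RInt_gen (gamma_integrand x) (at_right 0) (Rbar_locally p_infty) l /\
    forall a b, 0 < a -> a <= b -> RInt (gamma_integrand x) a b <= l.
Proof.
  intros Hx; destruct (gamma_integrand_decay x Hx) as (C & HC & Hle).
  apply (is_RInt_gen_bounded _ (2 * C)).
  - intros; apply continuous_gamma_integrand; auto.
  - intros; left; apply gamma_integrand_pos.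
  - intros a b Ha Hab.
    assert (Hmaj : is_RInt (fun t => C * exp (- t / 2)) a b
      (minus (- 2 * C * exp (- b / 2)) (- 2 * C * exp (- a / 2)))).
    { apply (is_RInt_derive (fun t => - 2 * C * exp (- t / 2))).
      - intros t _; auto_derive; auto; unfold Rdiv; field.
      - intros t _.
        apply (ex_derive_continuous (fun t => C * exp (- t / 2))); auto_derive; auto. }
    apply Rle_trans with (minus (- 2 * C * exp (- b / 2)) (- 2 * C * exp (- a / 2))).
    + eapply is_RInt_le; [exact Hab|apply (RInt_correct (V := R_CompleteNormedModule))|exact Hmaj|].
      * apply (ex_RInt_continuous (V := R_CompleteNormedModule)).
        intros z Hz; rewrite Rmin_left in Hz by lra.
        apply continuous_gamma_integrand; lra.
      * intros; apply Hle; lra.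
    + unfold minus, plus, opp; simpl.
      assert (exp (- a / 2) < 1) by (rewrite <- exp_0; apply exp_increasing; lra).
      assert (0 < exp (- b / 2)) by apply exp_pos.
      nra.
Qed.

Lemma is_RInt_gen_Gamma (x : R) : 1 <= x ->
  is_RInt_gen (gamma_integrand x) (at_right 0) (Rbar_locally p_infty) (Gamma x).
Proof.
  intros Hx; destruct (gamma_integral_exists x Hx) as (l & Hl & _).
  unfold Gamma; fold (gamma_integrand x).
  now rewrite (is_RInt_gen_unique (gamma_integrand x) l Hl).
Qed.

Lemma Gamma_pos (x : R) : 1 <= x -> 0 < Gamma x.
Proof.
  intros Hx; destruct (gamma_integral_exists x Hx) as (l & Hl & Hub).
  unfold Gamma; fold (gamma_integrand x).
  rewrite (is_RInt_gen_unique (gamma_integrand x) l Hl).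
  apply Rlt_le_trans with (RInt (gamma_integrand x) 1 2); [|apply Hub; lra].
  apply RInt_gt_0; [lra|intros; apply gamma_integrand_pos|].
  intros; apply continuous_gamma_integrand; lra.
Qed.

(** For t <= 1 the integrand t^x e^(-t) is at most t, since x >= 1. *)
Lemma gamma_integrand_lim_0 (x : R) : 1 <= x ->
  filterlim (gamma_integrand (x + 1)) (at_right 0) (locally 0).
Proof.
  intros Hx; apply filterlim_locally; intros eps.
  assert (He := cond_pos eps).
  assert (Hd : 0 < Rmin 1 eps) by (apply Rmin_glb_lt; lra).
  exists (mkposreal _ Hd); intros t Ht H0.
  apply Rabs_lt_between' in Ht; simpl in Ht.
  assert (Rmin 1 eps <= 1) by apply Rmin_l.
  assert (Rmin 1 eps <= eps) by apply Rmin_r.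
  assert (Hpos := gamma_integrand_pos (x + 1) t).
  enough (gamma_integrand (x + 1) t <= t) by (apply Rabs_lt_between'; lra).
  unfold gamma_integrand; replace (x + 1 - 1) with x by ring.
  assert (Rpower t x <= t).
  { rewrite <- (exp_ln t) at 2 by lra; unfold Rpower.
    assert (ln t <= 0) by (rewrite <- ln_1; apply ln_le; lra).
    destruct (Req_dec (x * ln t) (ln t)) as [->|]; [lra|].
    left; apply exp_increasing; nra. }
  assert (exp (- t) < 1) by (rewrite <- exp_0; apply exp_increasing; lra).
  assert (0 < exp (- t)) by apply exp_pos.
  assert (0 < Rpower t x) by apply exp_pos.
  nra.
Qed.

(** The integrand for x is 1 / t times the bounded integrand for x + 1. *)
Lemma gamma_integrand_lim_infty (x : R) : 1 <= x ->
  filterlim (gamma_integrand x) (Rbar_locally p_infty) (locally 0).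
Proof.
  intros Hx; apply filterlim_locally; intros eps.
  assert (He := cond_pos eps).
  destruct (gamma_integrand_decay (x + 1)) as (C & HC & Hle); [lra|].
  exists (C / eps); intros t Ht.
  assert (0 < C / eps) by (apply Rdiv_lt_0_compat; lra).
  assert (Hpos := gamma_integrand_pos x t).
  enough (gamma_integrand x t < eps) by (apply Rabs_lt_between'; lra).
  assert (Hb : gamma_integrand (x + 1) t <= C).
  { assert (exp (- t / 2) < 1) by (rewrite <- exp_0; apply exp_increasing; lra).
    specialize (Hle t ltac:(lra)); nra. }
  rewrite gamma_integrand_add, Rpower_1 in Hb by lra.
  assert (C < t * eps).
  { apply (Rmult_lt_compat_r eps) in Ht; auto.
    unfold Rdiv in Ht; rewrite Rmult_assoc, Rinv_l in Ht; lra. }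
  apply (Rmult_lt_reg_l t); lra.
Qed.

(** x times the integrand for x, minus the integrand for x + 1, is the derivative
    of the latter, which vanishes at both ends of the half-line. *)
Lemma Gamma_succ (x : R) : 1 <= x -> Gamma (x + 1) = x * Gamma x.
Proof.
  intros Hx.
  assert (HD : is_RInt_gen (Derive (gamma_integrand (x + 1)))
    (at_right 0) (Rbar_locally p_infty) (0 - 0)).
  { apply is_RInt_gen_Derive.
    - apply filter_prod_pos; intros a b Ha Hab t; simpl.
      rewrite Rmin_left by lra; intros Ht.
      eexists; apply is_derive_gamma_integrand; lra.
    - apply filter_prod_pos; intros a b Ha Hab t; simpl.
      rewrite Rmin_left by lra; intros Ht.
      apply (continuous_ext_loc _
        (fun t => minus (scal x (gamma_integrand x t)) (gamma_integrand (x + 1) t))).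
      + assert (Ht0 : 0 < t) by lra.
        exists (mkposreal t Ht0); intros u Hu.
        apply Rabs_lt_between' in Hu; simpl in Hu.
        symmetry; apply is_derive_unique, is_derive_gamma_integrand; lra.
      + apply (continuous_minus (V := R_NormedModule)).
        * apply (continuous_scal_r (V := R_NormedModule)).
          apply continuous_gamma_integrand; lra.
        * apply continuous_gamma_integrand; lra.
    - now apply gamma_integrand_lim_0.
    - apply gamma_integrand_lim_infty; lra. }
  assert (HS := is_RInt_gen_minus _ _ _ _
    (is_RInt_gen_scal _ x _ (is_RInt_gen_Gamma x Hx)) HD).
  assert (Hx1 : 1 <= x + 1) by lra.
  unfold Gamma at 1; fold (gamma_integrand (x + 1)).
  apply (is_RInt_gen_unique (gamma_integrand (x + 1))).
  replace (x * Gamma x) with (minus (scal x (Gamma x)) (0 - 0)).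
  2:{ unfold minus, plus, opp, scal; simpl; unfold mult; simpl; ring. }
  eapply is_RInt_gen_ext; [|exact HS].
  apply filter_prod_pos; intros a b Ha Hab t; simpl.
  rewrite Rmin_left by lra; intros Ht.
  rewrite (is_derive_unique _ _ _ (is_derive_gamma_integrand x t ltac:(lra))).
  unfold minus, plus, opp, scal; simpl; unfold mult; simpl; ring.
Qed.

(** * Wendel's inequalities *)

(** Concavity of r^a, compared with its tangent at r = 1. With z = ln r it says
    that exp at a z, a weighted mean of 0 and z, lies below the chord; the
    inequality 1 + w <= exp w at w = - a z and w = z - a z proves this after
    division by exp (a z). *)
Lemma Rpower_le_tangent (r a : R) : 0 < r -> 0 <= a <= 1 ->
  Rpower r a <= 1 - a + a * r.
Proof.
  intros Hr Ha; unfold Rpower; set (z := ln r).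
  replace r with (exp z) by (apply exp_ln; auto).
  assert (H1 := exp_ineq1_le (- (a * z))).
  assert (H2 := exp_ineq1_le (z - a * z)).
  assert (H3 : 1 <= (1 - a) * exp (- (a * z)) + a * exp (z - a * z)) by nra.
  assert (E0 : exp (a * z) * exp (- (a * z)) = 1).
  { rewrite <- exp_plus, <- exp_0; f_equal; ring. }
  assert (E1 : exp (a * z) * exp (z - a * z) = exp z).
  { rewrite <- exp_plus; f_equal; ring. }
  apply (Rmult_le_compat_l (exp (a * z))) in H3; [|left; apply exp_pos].
  rewrite Rmult_plus_distr_l in H3.
  replace (exp (a * z) * ((1 - a) * exp (- (a * z)))) with
    ((1 - a) * (exp (a * z) * exp (- (a * z)))) in H3 by ring.
  replace (exp (a * z) * (a * exp (z - a * z))) with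
    (a * (exp (a * z) * exp (z - a * z))) in H3 by ring.
  rewrite E0, E1 in H3; lra.
Qed.

(** The tangent bound at t = x is sharp enough because x is the mean of t under
    the weight t^(x-1) e^(-t), that is Gamma (x + 1) / Gamma x = x: the correction
    terms then integrate to zero. *)
Lemma Gamma_add_le (x a : R) : 1 <= x -> 0 <= a <= 1 ->
  Gamma (x + a) <= Rpower x a * Gamma x.
Proof.
  intros Hx Ha.
  assert (Hmaj : is_RInt_gen (fun t => Rpower x a *
      ((1 - a) * gamma_integrand x t + a / x * gamma_integrand (x + 1) t))
    (at_right 0) (Rbar_locally p_infty)
    (Rpower x a * ((1 - a) * Gamma x + a / x * Gamma (x + 1)))).
  { apply (is_RInt_gen_scal (V := R_NormedModule)).
    apply (is_RInt_gen_plus (V := R_NormedModule));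
      apply (is_RInt_gen_scal (V := R_NormedModule)); apply is_RInt_gen_Gamma; lra. }
  assert (Hxa := is_RInt_gen_Gamma (x + a) ltac:(lra)).
  assert (Hpos := Gamma_pos (x + a) ltac:(lra)).
  eapply RInt_gen_norm in Hmaj; [| | |exact Hxa].
  - rewrite Gamma_succ in Hmaj by lra.
    unfold norm in Hmaj; simpl in Hmaj; unfold abs in Hmaj; simpl in Hmaj.
    rewrite Rabs_pos_eq in Hmaj by lra.
    eapply Rle_trans; [exact Hmaj|right; field; lra].
  - apply filter_prod_pos; simpl; auto.
  - apply filter_prod_pos; intros b c Hb Hbc t Ht; simpl in *.
    unfold norm; simpl; unfold abs; simpl.
    rewrite Rabs_pos_eq by (left; apply gamma_integrand_pos).
    assert (Ht0 : 0 < t) by lra.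
    assert (Htx : 0 < t / x) by (apply Rdiv_lt_0_compat; lra).
    assert (E : Rpower t a = Rpower x a * Rpower (t / x) a).
    { rewrite Rpower_mult_distr by lra; f_equal; field; lra. }
    rewrite !gamma_integrand_add, Rpower_1, E, Rmult_assoc by lra.
    apply Rmult_le_compat_l; [left; apply exp_pos|].
    assert (H := Rpower_le_tangent (t / x) a Htx Ha).
    assert (Hg := gamma_integrand_pos x t).
    apply (Rmult_le_compat_r (gamma_integrand x t)) in H; [|lra].
    eapply Rle_trans; [exact H|right; field; lra].
Qed.

Definition log_gamma_quotient (a u : R) : R :=
  ln (Gamma u) + a * ln u - ln (Gamma (u + a)).

(** Wendel's inequality from both sides: from u up to u + a, and from u + a up to
    u + 1 with the complementary exponent 1 - a. *)
Lemma log_gamma_quotient_bounds (a u : R) : 0 <= a <= 1 -> 1 <= u ->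
  0 <= log_gamma_quotient a u <= 1 / u.
Proof.
  intros Ha Hu; unfold log_gamma_quotient.
  assert (Hlow := Gamma_add_le u a Hu Ha).
  assert (Hup := Gamma_add_le (u + a) (1 - a) ltac:(lra) ltac:(lra)).
  replace (u + a + (1 - a)) with (u + 1) in Hup by ring.
  rewrite Gamma_succ in Hup by lra.
  assert (HG := Gamma_pos u Hu).
  assert (HGa := Gamma_pos (u + a) ltac:(lra)).
  apply ln_le in Hlow; [|lra]; apply ln_le in Hup; [|nra].
  unfold Rpower in Hlow, Hup.
  rewrite ln_mult, ln_exp in Hlow by auto using exp_pos.
  rewrite (ln_mult (exp _)), ln_exp in Hup by auto using exp_pos.
  rewrite ln_mult in Hup by lra.
  split; [lra|].
  assert (Hln : ln (u + a) - ln u <= a / u).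
  { rewrite <- ln_div by lra.
    assert (H := exp_ineq1_le (ln ((u + a) / u))).
    rewrite exp_ln in H by (apply Rdiv_lt_0_compat; lra).
    replace ((u + a) / u) with (1 + a / u) in * by (field; lra); lra. }
  assert (Hinv : 0 < 1 / u) by (apply Rdiv_lt_0_compat; lra).
  assert (Hln0 : ln u <= ln (u + a)) by (apply ln_le; lra).
  replace (a / u) with (a * (1 / u)) in Hln by (field; lra).
  nra.
Qed.

Lemma log_gamma_quotient_step (a u : R) : 0 <= a <= 1 -> 1 <= u ->
  log_gamma_quotient a u - log_gamma_quotient a (u + 1)
    = ln (u + a) - (1 - a) * ln u - a * ln (u + 1).
Proof.
  intros Ha Hu; unfold log_gamma_quotient.
  replace (u + 1 + a) with (u + a + 1) by ring.
  rewrite !Gamma_succ by lra.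
  rewrite !ln_mult by (lra || apply Gamma_pos; lra).
  ring.
Qed.

(** * The sawtooth integral *)

Lemma phi_between (a t : R) (k : Z) : IZR k <= t < IZR k + 1 ->
  phi a t = if Rle_dec (t - IZR k) a then 1 - a else - a.
Proof.
  intros Ht; unfold phi, frac_part.
  now rewrite <- (Int_part_spec t k) by lra.
Qed.

Lemma phi_abs_le (a t : R) : 0 <= a <= 1 -> Rabs (phi a t) <= 1.
Proof.
  intros Ha; unfold phi; destruct Rle_dec; apply Rabs_le; lra.
Qed.

Lemma is_RInt_scal_inv (m c p q : R) : 0 < c + p -> p <= q ->
  is_RInt (fun t => m / (c + t)) p q (m * ln (c + q) - m * ln (c + p)).
Proof.
  intros Hp Hpq.
  apply (is_RInt_derive (fun t => m * ln (c + t)));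
    intros t; rewrite Rmin_left by lra; intros Ht.
  - auto_derive; [lra|field; lra].
  - apply (ex_derive_continuous (fun t => m / (c + t))); auto_derive; lra.
Qed.

(** The integrand agrees with a smooth one on the open intervals to the left and
    to the right of k + a; this includes a = 0 and a = 1, when one of the two is
    empty. *)
Lemma is_RInt_phi_period (a c : R) (k : Z) : 0 <= a <= 1 -> 0 < c + IZR k ->
  is_RInt (fun t => phi a t / (c + t)) (IZR k) (IZR k + 1)
    (ln (c + IZR k + a) - (1 - a) * ln (c + IZR k) - a * ln (c + IZR k + 1)).
Proof.
  intros Ha Hk.
  replace (ln _ - _ - _) with
    (plus ((1 - a) * ln (c + (IZR k + a)) - (1 - a) * ln (c + IZR k))
       (- a * ln (c + (IZR k + 1)) - - a * ln (c + (IZR k + a)))).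
  2:{ unfold plus; simpl; rewrite <- !Rplus_assoc; ring. }
  apply (is_RInt_Chasles (V := R_NormedModule) _ _ (IZR k + a)).
  - apply (is_RInt_ext (fun t => (1 - a) / (c + t))).
    + intros t; rewrite Rmin_left, Rmax_right by lra; intros Ht.
      rewrite (phi_between a t k) by lra; destruct Rle_dec; [auto|lra].
    + apply is_RInt_scal_inv; lra.
  - apply (is_RInt_ext (fun t => - a / (c + t))).
    + intros t; rewrite Rmin_left, Rmax_right by lra; intros Ht.
      rewrite (phi_between a t k) by lra; destruct Rle_dec; [lra|auto].
    + apply is_RInt_scal_inv; lra.
Qed.

Lemma is_RInt_phi_periods (a c : R) (k : Z) (n : nat) :
  0 <= a <= 1 -> 1 <= c + IZR k ->
  is_RInt (fun t => phi a t / (c + t)) (IZR k) (IZR k + INR n)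
    (log_gamma_quotient a (c + IZR k) - log_gamma_quotient a (c + IZR k + INR n)).
Proof.
  intros Ha Hk; induction n as [|n IH].
  - simpl; rewrite !Rplus_0_r, Rminus_diag; apply (is_RInt_point (V := R_NormedModule)).
  - assert (Hn := pos_INR n).
    assert (Ek : IZR k + INR n = IZR (k + Z.of_nat n)).
    { rewrite plus_IZR, <- INR_IZR_INZ; reflexivity. }
    assert (Hper := is_RInt_phi_period a c (k + Z.of_nat n) Ha).
    rewrite <- Ek, <- Rplus_assoc, <- log_gamma_quotient_step in Hper by lra.
    rewrite S_INR, <- !Rplus_assoc.
    replace (_ - _) with
      (plus (log_gamma_quotient a (c + IZR k) - log_gamma_quotient a (c + IZR k + INR n))
         (log_gamma_quotient a (c + IZR k + INR n)
            - log_gamma_quotient a (c + IZR k + INR n + 1)))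
      by (unfold plus; simpl; ring).
    apply (is_RInt_Chasles (V := R_NormedModule) _ _ _ _ _ _ IH), Hper; lra.
Qed.

(** For a real upper limit T the whole periods up to the floor of T leave an
    error q(u + n), and the incomplete last period contributes at most its length
    divided by u + n; both are at most 1 / n. *)
Lemma is_RInt_gen_phi (a c : R) (k : Z) : 0 <= a <= 1 -> 1 <= c + IZR k ->
  is_RInt_gen (fun t => phi a t / (c + t)) (at_point (IZR k))
    (Rbar_locally p_infty) (log_gamma_quotient a (c + IZR k)).
Proof.
  intros Ha Hk; apply filterlimi_locally; intros eps.
  assert (He := cond_pos eps).
  assert (H2e : 0 < 2 / eps) by (apply Rdiv_lt_0_compat; lra).
  apply (Filter_prod _ _ _ (fun p => p = IZR k) (fun T => IZR k + 2 / eps + 1 < T)).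
  { reflexivity. }
  { exists (IZR k + 2 / eps + 1); auto. }
  intros p T -> HT; simpl.
  destruct (base_Int_part T) as [Hfl1 Hfl2].
  set (n := Z.to_nat (Int_part T - k)).
  assert (Hkn : (k <= Int_part T)%Z) by (apply le_IZR; lra).
  assert (En : IZR k + INR n = IZR (Int_part T)).
  { unfold n; rewrite INR_IZR_INZ, Z2Nat.id, minus_IZR by lia; ring. }
  assert (HI := is_RInt_phi_periods a c k n Ha Hk).
  assert (Htail : ex_RInt (fun t => phi a t / (c + t)) (IZR k + INR n) T).
  { apply (ex_RInt_Chasles_1 (V := R_CompleteNormedModule) _ _ _ (IZR k + INR n + 1)).
    - lra.
    - rewrite En; eexists; apply is_RInt_phi_period; lra. }
  destruct Htail as [r Hr].
  exists (plus (log_gamma_quotient a (c + IZR k)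
    - log_gamma_quotient a (c + IZR k + INR n)) r).
  split; [eapply (is_RInt_Chasles (V := R_NormedModule)); eassumption|].
  assert (Hn : 2 / eps < INR n) by lra.
  assert (Hq := log_gamma_quotient_bounds a (c + IZR k + INR n) Ha ltac:(lra)).
  assert (Hinv : 1 / (c + IZR k + INR n) <= 1 / INR n).
  { apply Rmult_le_compat_l; [lra|apply Rinv_le_contravar; lra]. }
  assert (Heps : 1 / INR n < eps / 2).
  { replace (eps / 2) with (/ (2 / eps)) by (field; lra).
    unfold Rdiv at 1; rewrite Rmult_1_l; apply Rinv_lt_contravar; [nra|auto]. }
  assert (Hinv0 : 0 < 1 / INR n) by (apply Rdiv_lt_0_compat; lra).
  assert (Hrb : Rabs r <= (T - (IZR k + INR n)) * (1 / INR n)).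
  { apply (norm_RInt_le_const (V := R_NormedModule)
      (fun t => phi a t / (c + t)) (IZR k + INR n) T); [lra| |exact Hr].
    intros t Ht; unfold norm; simpl; unfold abs; simpl.
    unfold Rdiv; rewrite Rabs_mult.
    apply Rmult_le_compat; try apply Rabs_pos; [now apply phi_abs_le|].
    rewrite Rabs_pos_eq by (left; apply Rinv_0_lt_compat; lra).
    apply Rinv_le_contravar; lra. }
  apply Rabs_le_between in Hrb.
  unfold plus; simpl; apply Rabs_lt_between'; nra.
Qed.

Lemma exp_log_gamma_quotient (a u : R) : 0 <= a <= 1 -> 1 <= u ->
  exp (log_gamma_quotient a u) = Gamma u * Rpower u a / Gamma (u + a).
Proof.
  intros Ha Hu; unfold log_gamma_quotient, Rminus, Rdiv.
  rewrite !exp_plus, exp_Ropp, !exp_ln by (apply Gamma_pos; lra).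
  reflexivity.
Qed.

Theorem theorem6 :
  (forall x alpha : R, 0 <= x -> 0 <= alpha <= 1 ->
     ex_RInt_infty (fun t => phi alpha t / (x + t)) 1 /\
     Pi_hat x alpha / Pi (x + alpha)
       = exp (RInt_infty (fun t => phi alpha t / (x + t)) 1))
  /\
  (forall y s : R, 1 <= y -> 0 <= s <= 1 ->
     ex_RInt_infty (fun t => phi s t / (y + t)) 0 /\
     Gamma (y + 1) / Gamma (y + s)
       = Rpower y (1 - s) * exp (RInt_infty (fun t => phi s t / (y + t)) 0)).
Proof.
  split.
  - intros x a Hx Ha.
    assert (HI := is_RInt_gen_phi a x 1 Ha ltac:(lra)).
    split; [eexists; exact HI|].
    unfold RInt_infty.
    rewrite (is_RInt_gen_unique (fun t => phi a t / (x + t)) _ HI).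
    rewrite exp_log_gamma_quotient by lra.
    assert (HG := Gamma_pos (x + 1) ltac:(lra)).
    unfold Pi_hat, Pi; rewrite (Gamma_succ (x + 1)) by lra.
    rewrite <- Rpower_mult_distr by lra.
    replace (x + a + 1) with (x + 1 + a) by ring.
    replace (Gamma (x + 1) * Rpower (x + 1) a)
      with (Rpower (Gamma (x + 1)) (1 - a + a) * Rpower (x + 1) a)
      by (replace (1 - a + a) with 1 by ring; rewrite Rpower_1 by lra; ring).
    rewrite Rpower_plus; unfold Rdiv; ring.
  - intros y s Hy Hs.
    assert (HI := is_RInt_gen_phi s y 0 Hs ltac:(lra)).
    split; [eexists; exact HI|].
    unfold RInt_infty.
    rewrite (is_RInt_gen_unique (fun t => phi s t / (y + t)) _ HI).
    rewrite Rplus_0_r, exp_log_gamma_quotient, Gamma_succ by lra.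
    replace y with (Rpower y (1 - s + s)) at 1
      by (replace (1 - s + s) with 1 by ring; apply Rpower_1; lra).
    rewrite Rpower_plus; unfold Rdiv; ring.
Qed.
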